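(* Let $B\subseteq\Lambda$ be a ring extension, with inclusion map $\iota\colon B\hookrightarrow\Lambda$. Assume that $\Lambda$ is finitely generated and projective as a right $B$-module. (i) The following statements are equivalent: (1) The inclusion $\iota\colon B\hookrightarrow\Lambda$ splits as a map of right $B$-modules. (2) $\Lambda/\iota(B)$ is projective as a right $B$-module. (3) $\Lambda$ is a projective generator as a right $B$-module. (4) The counit $\varepsilon\colon \operatorname{Hom}_{B^{\mathrm{op}}}(\Lambda,B)\to B$, $f\mapsto f(1)$, of the right dual coring $\operatorname{Hom}_{B^{\mathrm{op}}}(\Lambda,B)$ is surjective. (ii) The following statements are equivalent: (1) There is a splitting of the inclusion $\iota\colon B\hookrightarrow\Lambda$ as right $B$-modules whose kernel is a right ideal of $\Lambda$. (2) The right dual coring $\operatorname{Hom}_{B^{\mathrm{op}}}(\Lambda,B)$ is normal.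
   Context: Rings are associative and unital, and subrings share the unit. $\operatorname{Hom}_{B^{\mathrm{op}}}$ denotes homomorphisms of right $B$-modules. A $B$-coring is a $B$-$B$-bimodule $W$ with $B$-$B$-bilinear maps $\mu\colon W\to W\otimes_B W$ (comultiplication) and $\varepsilon\colon W\to B$ (counit) such that $(\mu\otimes 1)\mu=(1\otimes\mu)\mu$ and, under the identifications $W\otimes_B B\cong W\cong B\otimes_B W$, $(1\otimes\varepsilon)\mu=\mathrm{id}_W=(\varepsilon\otimes 1)\mu$. The $B$-coring $W$ is called normal if it contains a group-like element, i.e. an element $\omega\in W$ with $\mu(\omega)=\omega\otimes\omega$ and $\varepsilon(\omega)=1$. Right dual coring: if $B\subseteq\Lambda$ is a ring extension with $\Lambda$ finitely generated projective as a right $B$-module, put $W=\operatorname{Hom}_{B^{\mathrm{op}}}(\Lambda,B)$, a $B$-$B$-bimodule via $(bf)(x)=b f(x)$ and $(fb)(x)=f(bx)$. The map $\psi\colon W\otimes_B W\to\operatorname{Hom}_{B^{\mathrm{op}}}(\Lambda\otimes_B\Lambda,B)$, $\psi(f\otimes g)(x\otimes y)=f(g(x)y)$, is bijective. $W$ is a $B$-coring with counit $\varepsilon(f)=f(1)$ and comultiplication $\mu=\psi^{-1}\circ\operatorname{Hom}_{B^{\mathrm{op}}}(m,B)$, where $m\colon\Lambda\otimes_B\Lambda\to\Lambda$ is the multiplication. *)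

(* Defs.v *)
From HB Require Import structures.
From mathcomp Require Import all_boot all_algebra.
From mathcomp.multinomials Require Import freeg.
From mathcomp Require Import boolp.

Set Implicit Arguments.
Unset Strict Implicit.
Unset Printing Implicit Defensive.

Import GRing.Theory.
Local Open Scope ring_scope.
Local Open Scope quotient_scope.

(* Rings are pzRingType's: associative and unital, possibly zero.
   A right B-module is an lmodType over the converse ring B^c, so that the
   right action of b on x is the scaling (b : B^c) *: x. *)

Definition surj (T U : Type) (f : T -> U) : Prop :=
  forall y : U, exists x : T, f x = y.

Section ModuleNotions.
Variable R : pzRingType.

Definition fin_generated (P : lmodType R) : Prop :=
  exists (n : nat) (e : 'I_n -> P),
    forall x : P, exists c : 'I_n -> R, x = \sum_(i < n) c i *: e i.

Definition projective (P : lmodType R) : Prop :=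
  forall (M N : lmodType R) (g : {linear M -> N}) (f : {linear P -> N}),
    surj g -> exists h : {linear P -> M}, forall x : P, g (h x) = f x.

(* Hom(P, -) is faithful. *)
Definition generator (P : lmodType R) : Prop :=
  forall (M N : lmodType R) (f g : {linear M -> N}),
    (forall (h : {linear P -> M}) (x : P), f (h x) = g (h x)) ->
    forall y : M, f y = g y.

End ModuleNotions.

Section Cokernel.
Variables (R : pzRingType) (U M : lmodType R) (f : {linear U -> M}).

Definition im_pred : {pred M} := fun y => `[< exists u : U, y = f u >].

Fact im_pred_closed : zmod_closed im_pred.
Proof.
split; first by apply/asboolP; exists 0; rewrite linear0.
move=> x y /asboolP[u ->] /asboolP[v ->].
by apply/asboolP; exists (u - v); rewrite linearB.
Qed.
HB.instance Definition _ := GRing.isZmodClosed.Build M im_pred im_pred_closed.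

Definition coker : Type := Quotient.quot im_pred.
HB.instance Definition _ := GRing.Zmodule.on coker.
HB.instance Definition _ : EqQuotient M (Quotient.equiv im_pred) coker :=
  EqQuotient.on coker.

Definition coker_pi (x : M) : coker := \pi x.
Definition coker_scale (a : R) (x : coker) : coker := coker_pi (a *: repr x).

Lemma coker_piP (x y : M) :
  (coker_pi x = coker_pi y) <-> exists u, x - y = f u.
Proof.
split; first by move/eqP; rewrite eqmodE => /asboolP.
by move=> h; apply/eqP; rewrite eqmodE; apply/asboolP.
Qed.

Lemma coker_reprK (x : coker) : coker_pi (repr x) = x.
Proof. exact: reprK. Qed.

Lemma coker_piD (x y : M) : coker_pi (x + y) = coker_pi x + coker_pi y.
Proof. exact: (Quotient.pi_add im_pred). Qed.

Lemma coker_piZ a (x : M) : coker_scale a (coker_pi x) = coker_pi (a *: x).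
Proof.
rewrite /coker_scale; apply/esym/coker_piP.
have /esym/coker_piP[u xu] := coker_reprK (coker_pi x).
by exists (a *: u); rewrite linearZ_LR -xu scalerBr.
Qed.

Fact coker_scaleA a b x :
  coker_scale a (coker_scale b x) = coker_scale (a * b) x.
Proof.
by rewrite -[x]coker_reprK; move: (repr x) => z; rewrite !coker_piZ scalerA.
Qed.

Fact coker_scale1 : left_id 1 coker_scale.
Proof.
by move=> x; rewrite -[x]coker_reprK; move: (repr x) => z; rewrite coker_piZ scale1r.
Qed.

Fact coker_scaleDr : right_distributive coker_scale +%R.
Proof.
move=> a x y; rewrite -[x]coker_reprK -[y]coker_reprK.
by move: (repr x) (repr y) => z w; rewrite -coker_piD !coker_piZ scalerDr coker_piD.
Qed.

Fact coker_scaleDl x : {morph coker_scale^~ x : a b / a + b}.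
Proof.
move=> a b; rewrite -[x]coker_reprK; move: (repr x) => z.
by rewrite !coker_piZ scalerDl coker_piD.
Qed.

HB.instance Definition _ := GRing.Zmodule_isLmodule.Build R coker
  coker_scaleA coker_scale1 coker_scaleDr coker_scaleDl.

End Cokernel.

HB.mixin Record isBimodule (B : pzRingType) M of GRing.Lmodule (B^c) M := {
  lact : B -> M -> M;
  lactA : forall a b x, lact a (lact b x) = lact (a * b) x;
  lact1 : forall x, lact 1 x = x;
  lactDr : forall a x y, lact a (x + y) = lact a x + lact a y;
  lactDl : forall a b x, lact (a + b) x = lact a x + lact b x;
  lact_scale : forall a (b : B^c) x, lact a (b *: x) = b *: lact a x
}.

#[short(type="bimodType")]
HB.structure Definition Bimodule (B : pzRingType) :=
  {M of isBimodule B M & GRing.Lmodule (B^c) M}.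

Notation "b *:l x" := (lact b x) (at level 40, left associativity).
Notation "x *:r b" := (@GRing.scale (GRing.converse _) _ b x)
  (at level 40, left associativity).

Section BimoduleTheory.
Variable B : pzRingType.
Implicit Types (M : bimodType B) (a b : B).

Lemma ractA M (x : M) a b : x *:r a *:r b = x *:r (a * b).
Proof. exact: (@scalerA (B^c)). Qed.
Lemma ract1 M (x : M) : x *:r (1 : B) = x.
Proof. exact: (@scale1r (B^c)). Qed.
Lemma ractDl M (x y : M) a : (x + y) *:r a = x *:r a + y *:r a.
Proof. exact: (@scalerDr (B^c)). Qed.
Lemma ractDr M (x : M) a b : x *:r (a + b) = x *:r a + x *:r b.
Proof. exact: (@scalerDl (B^c)). Qed.
Lemma lract M (x : M) a b : (a *:l x) *:r b = a *:l (x *:r b).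
Proof. by rewrite lact_scale. Qed.
Lemma lact_sum M a I (r : seq I) (F : I -> M) :
  a *:l (\sum_(i <- r) F i) = \sum_(i <- r) a *:l F i.
Proof.
apply: (big_morph (fun x : M => a *:l x)); first exact: lactDr.
by apply: (@addrI _ (a *:l (0 : M))); rewrite -lactDr !addr0.
Qed.

End BimoduleTheory.

(* B-B-bilinear maps; linearity over B^c is right B-linearity. *)
Record bihom (B : pzRingType) (M N : bimodType B) := BiHom {
  bihom_fun :> {linear M -> N};
  bihom_lact : forall (a : B) (x : M), bihom_fun (a *:l x) = a *:l bihom_fun x
}.

(* B as a B-B-bimodule: an alias of (B^c)^o, hence x *:r b = x * b in B. *)
Definition rreg (B : pzRingType) : Type := (B^c)^o.
HB.instance Definition _ (B : pzRingType) := GRing.Lmodule.on (rreg B).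

Section RegularBimodule.
Variable B : pzRingType.
Definition rreg_lact (a : B) (x : rreg B) : rreg B := a * (x : B).
Fact rreg_lactA a b x : rreg_lact a (rreg_lact b x) = rreg_lact (a * b) x.
Proof. exact: (@mulrA B). Qed.
Fact rreg_lact1 x : rreg_lact 1 x = x.
Proof. exact: (@mul1r B). Qed.
Fact rreg_lactDr a x y : rreg_lact a (x + y) = rreg_lact a x + rreg_lact a y.
Proof. exact: (@mulrDr B). Qed.
Fact rreg_lactDl a b x : rreg_lact (a + b) x = rreg_lact a x + rreg_lact b x.
Proof. exact: (@mulrDl B). Qed.
Fact rreg_lact_scale a (b : B^c) x : rreg_lact a (b *: x) = b *: rreg_lact a x.
Proof. exact: (@mulrA B). Qed.
HB.instance Definition _ := isBimodule.Build B (rreg B)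
  rreg_lactA rreg_lact1 rreg_lactDr rreg_lactDl rreg_lact_scale.
Lemma rreg_ractE (x : rreg B) (b : B) : x *:r b = (x : B) * b :> B.
Proof. by []. Qed.
End RegularBimodule.

Section Tensor.
Variables (B : pzRingType) (M N : bimodType B).

Definition pure (x : M) (y : N) : {freeg (M * N)%type} := << (x, y) >>.

Definition tensor_rel (z : {freeg (M * N)%type}) : Prop :=
  [\/ exists x x' y, z = pure (x + x') y - pure x y - pure x' y,
      exists x y y', z = pure x (y + y') - pure x y - pure x y'
    | exists x (b : B) y, z = pure (x *:r b) y - pure x (b *:l y)].

(* The subgroup generated by the relations. *)
Definition tensor_ker : {pred {freeg (M * N)%type}} := fun z =>
  `[< forall S : {pred {freeg (M * N)%type}}, zmod_closed S ->
        (forall r, tensor_rel r -> r \in S) -> z \in S >].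

Fact tensor_ker_closed : zmod_closed tensor_ker.
Proof.
split; first by apply/asboolP => S [].
move=> x y /asboolP hx /asboolP hy; apply/asboolP => S SZ SR.
by case: (SZ) => _; apply; [apply: hx|apply: hy].
Qed.
HB.instance Definition _ := GRing.isZmodClosed.Build _ tensor_ker
  tensor_ker_closed.

Definition tensor : Type := Quotient.quot tensor_ker.
HB.instance Definition _ := GRing.Zmodule.on tensor.
HB.instance Definition _ : EqQuotient _ (Quotient.equiv tensor_ker) tensor :=
  EqQuotient.on tensor.

Definition tensor_pi (z : {freeg (M * N)%type}) : tensor := \pi z.
Definition tens (x : M) (y : N) : tensor := tensor_pi (pure x y).

Definition balanced (Z : zmodType) (f : M -> N -> Z) : Prop :=
  [/\ forall x x' y, f (x + x') y = f x y + f x' y,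
      forall x y y', f x (y + y') = f x y + f x y'
    & forall x (b : B) y, f (x *:r b) y = f x (b *:l y)].

(* The additive map x (x) y |-> f x y, meaningful when f is balanced. *)
Definition tensor_lift (Z : zmodType) (f : M -> N -> Z) (t : tensor) : Z :=
  fglift (fun p : M * N => f p.1 p.2 : zmodule Z) (repr t).

Lemma tensor_piD x y : tensor_pi (x + y) = tensor_pi x + tensor_pi y.
Proof. exact: (Quotient.pi_add tensor_ker). Qed.
Lemma tensor_piN x : tensor_pi (- x) = - tensor_pi x.
Proof. exact: (Quotient.pi_opp tensor_ker). Qed.
Lemma tensor_pi0 : tensor_pi 0 = 0.
Proof. by rewrite -(subrr 0) tensor_piD tensor_piN subrr. Qed.

Lemma tensor_reprK t : tensor_pi (repr t) = t.
Proof. exact: reprK. Qed.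
Lemma tensor_piP x y : (tensor_pi x = tensor_pi y) <-> x - y \in tensor_ker.
Proof. by split=> [/eqP|h]; [|apply/eqP]; rewrite eqmodE. Qed.

Lemma tensor_ker_rel r : tensor_rel r -> r \in tensor_ker.
Proof. by move=> hr; apply/asboolP => S _; apply. Qed.

Lemma tens_balanced : balanced tens.
Proof.
split=> *; rewrite /tens -?tensor_piD; apply/tensor_piP/tensor_ker_rel.
- by rewrite opprD addrA; constructor 1; do 3!eexists.
- by rewrite opprD addrA; constructor 2; do 3!eexists.
- by constructor 3; do 3!eexists.
Qed.

Lemma tensDl x x' y : tens (x + x') y = tens x y + tens x' y.
Proof. by case: tens_balanced. Qed.
Lemma tensDr x y y' : tens x (y + y') = tens x y + tens x y'.
Proof. by case: tens_balanced. Qed.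
Lemma tens_ract x (b : B) y : tens (x *:r b) y = tens x (b *:l y).
Proof. by case: tens_balanced. Qed.
Lemma tens0l y : tens 0 y = 0.
Proof. by apply: (@addrI _ (tens 0 y)); rewrite -tensDl !addr0. Qed.
Lemma tens0r x : tens x 0 = 0.
Proof. by apply: (@addrI _ (tens x 0)); rewrite -tensDr !addr0. Qed.
Lemma tensNl x y : tens (- x) y = - tens x y.
Proof. by apply: (@addrI _ (tens x y)); rewrite -tensDl !subrr tens0l. Qed.
Lemma tens_suml I (r : seq I) (F : I -> M) y :
  tens (\sum_(i <- r) F i) y = \sum_(i <- r) tens (F i) y.
Proof.
by apply: (big_morph (tens^~ y)) => [x x'|]; rewrite ?tensDl ?tens0l.
Qed.
Lemma tens_sumr I (r : seq I) (F : I -> N) x :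
  tens x (\sum_(i <- r) F i) = \sum_(i <- r) tens x (F i).
Proof. by apply: (big_morph (tens x)) => [y y'|]; rewrite ?tensDr ?tens0r. Qed.

Lemma tensor_ind (P : tensor -> Prop) :
  P 0 -> (forall x y t, P t -> P (tens x y + t)) -> forall t, P t.
Proof.
move=> P0 PD t; rewrite -[t]tensor_reprK -[repr t]freeg_sumE.
elim: (dom _) => [|[x y] s IHs]; first by rewrite big_nil tensor_pi0.
rewrite big_cons tensor_piD; move: (tensor_pi _) IHs => u Pu.
set k := coeff _ _; clearbody k.
have -> : << k *g (x, y) >> = << (x, y) >> *~ k :> {freeg (M * N)%type}.
  by rewrite freegU_mulz intz.
have PDn n x' : P (tensor_pi (pure x' y *+ n) + u).
  elim: n => [|n IHn]; first by rewrite mulr0n tensor_pi0 add0r.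
  by rewrite mulrS tensor_piD -addrA; apply: PD.
case: k => n; first exact: PDn.
have := PDn n.+1 (- x); congr (P (_ + _)).
have piMn z m : tensor_pi (z *+ m) = tensor_pi z *+ m.
  by elim: m => [|m IHm]; rewrite ?mulr0n ?tensor_pi0 // !mulrS tensor_piD IHm.
rewrite NegzE mulrNz tensor_piN -pmulrn !piMn -mulNrn; congr (_ *+ _).
exact: tensNl.
Qed.

Section Lift.
Variables (Z : zmodType) (f : M -> N -> Z).
Hypothesis fB : balanced f.

Let F (z : {freeg (M * N)%type}) : Z :=
  fglift (fun p : M * N => f p.1 p.2 : zmodule Z) z.

Let FB z z' : F (z - z') = F z - F z'.
Proof.
have := lift_is_additive (fun p : M * N => f p.1 p.2 : zmodule Z) z z'.
exact.
Qed.
Let F0 : F 0 = 0.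
Proof. by have := FB 0 0; rewrite !subrr. Qed.
Let Fpure x y : F (pure x y) = f x y.
Proof. by rewrite /F /pure liftU scale1r. Qed.

Lemma tensor_lift_pi z : tensor_lift f (tensor_pi z) = F z.
Proof.
apply/eqP; rewrite -subr_eq0 -FB.
have /tensor_piP/asboolP h := tensor_reprK (tensor_pi z).
suff : repr (tensor_pi z) - z \in [pred z | F z == 0] by rewrite inE.
apply: h => [|r]; last first.
  have [fDl fDr fr] := fB.
  case=> -[x [y [w ->]]]; rewrite inE !FB !Fpure.
  - by rewrite fDl addrAC addrK subrr.
  - by rewrite fDr addrAC addrK subrr.
  - by rewrite fr subrr.
split=> [|u v]; first by rewrite inE F0.
by rewrite !inE FB => /eqP -> /eqP ->; rewrite subrr.
Qed.

Lemma tensor_liftE x y : tensor_lift f (tens x y) = f x y.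
Proof. by rewrite tensor_lift_pi Fpure. Qed.

Lemma tensor_liftD : {morph tensor_lift f : s t / s + t}.
Proof.
move=> s t; rewrite -[s]tensor_reprK -[t]tensor_reprK -tensor_piD !tensor_lift_pi.
by apply: (@addIr _ (- F (repr t))); rewrite -FB !addrK.
Qed.

Lemma tensor_lift0 : tensor_lift f 0 = 0.
Proof. by apply: (@addrI _ (tensor_lift f 0)); rewrite -tensor_liftD !addr0. Qed.

End Lift.

Lemma tensor_ext (Z : zmodType) (g h : tensor -> Z) :
  {morph g : s t / s + t} -> {morph h : s t / s + t} ->
  (forall x y, g (tens x y) = h (tens x y)) -> forall t, g t = h t.
Proof.
move=> gD hD gh; apply: tensor_ind => [|x y t IHt]; last by rewrite gD hD gh IHt.
apply: (@addrI _ (g 0 + h 0)); rewrite -[in RHS]addrA -hD -[in LHS]addrAC -gD.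
by rewrite !addr0.
Qed.

Lemma tensor_lift_big (Z : zmodType) (f : M -> N -> Z) (fB : balanced f)
  I (r : seq I) (F : I -> tensor) :
  tensor_lift f (\sum_(i <- r) F i) = \sum_(i <- r) tensor_lift f (F i).
Proof.
apply: (big_morph _ (tensor_liftD fB)).
exact: tensor_lift0.
Qed.

Section Actions.
Implicit Types (a b : B) (s t : tensor).

Definition tensor_lact a : tensor -> tensor :=
  tensor_lift (fun x y => tens (a *:l x) y).
Definition tensor_ract (b : B^c) : tensor -> tensor :=
  tensor_lift (fun x y => tens x (b *: y)).

Lemma tensor_lact_bal a : balanced (fun x y => tens (a *:l x) y).
Proof.
by split=> *; rewrite ?lactDr ?tensDl ?tensDr // -lract tens_ract.
Qed.
Lemma tensor_ract_bal (b : B^c) : balanced (fun x y => tens x (b *: y)).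
Proof.
split=> *; rewrite ?scalerDr ?tensDl ?tensDr //.
by rewrite tens_ract lact_scale.
Qed.
Let lB := tensor_lact_bal.
Let rB := tensor_ract_bal.

Lemma tensor_lactE a x y : tensor_lact a (tens x y) = tens (a *:l x) y.
Proof. exact: tensor_liftE. Qed.
Lemma tensor_ractE (b : B^c) x y : tensor_ract b (tens x y) = tens x (b *: y).
Proof. exact: tensor_liftE. Qed.

Fact tensor_lactDr a : {morph tensor_lact a : s t / s + t}.
Proof. exact: tensor_liftD. Qed.
Fact tensor_ractDr (b : B^c) : {morph tensor_ract b : s t / s + t}.
Proof. exact: tensor_liftD. Qed.

Fact tensor_ractA (a b : B^c) t :
  tensor_ract a (tensor_ract b t) = tensor_ract (a * b) t.
Proof.
move: t; apply: tensor_ext => [s t|s t|x y]; rewrite ?tensor_ractDr //.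
by rewrite !tensor_ractE scalerA.
Qed.
Fact tensor_ract1 : left_id 1 tensor_ract.
Proof.
by apply: tensor_ext => [s t|s t|x y]; rewrite ?tensor_ractDr // tensor_ractE scale1r.
Qed.
Fact tensor_ractDl t : {morph tensor_ract^~ t : a b / a + b}.
Proof.
move=> a b /=; move: t; apply: tensor_ext => [s t|s t|x y]; rewrite ?tensor_ractDr //.
  by rewrite addrACA.
by rewrite !tensor_ractE scalerDl tensDr.
Qed.
HB.instance Definition _ := GRing.Zmodule_isLmodule.Build (B^c) tensor
  tensor_ractA tensor_ract1 tensor_ractDr tensor_ractDl.

Fact tensor_lactA a b t :
  tensor_lact a (tensor_lact b t) = tensor_lact (a * b) t.
Proof.
move: t; apply: tensor_ext => [s t|s t|x y]; rewrite ?tensor_lactDr //.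
by rewrite !tensor_lactE lactA.
Qed.
Fact tensor_lact1 t : tensor_lact 1 t = t.
Proof.
move: t; apply: tensor_ext => [s t|s t|x y]; rewrite ?tensor_lactDr //.
by rewrite tensor_lactE lact1.
Qed.
Fact tensor_lactDl a b t :
  tensor_lact (a + b) t = tensor_lact a t + tensor_lact b t.
Proof.
move: t; apply: tensor_ext => [s t|s t|x y]; rewrite ?tensor_lactDr //.
  by rewrite addrACA.
by rewrite !tensor_lactE lactDl tensDl.
Qed.
Fact tensor_lact_ract a (b : B^c) t :
  tensor_lact a (b *: t) = b *: tensor_lact a t.
Proof.
rewrite /GRing.scale /=; move: t; apply: tensor_ext => [s t|s t|x y];
  rewrite ?tensor_ractDr ?tensor_lactDr ?tensor_ractDr //.
by rewrite !(tensor_lactE, tensor_ractE).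
Qed.
HB.instance Definition _ := isBimodule.Build B tensor
  tensor_lactA tensor_lact1 tensor_lactDr tensor_lactDl tensor_lact_ract.

End Actions.

Lemma lact_tens a x y : a *:l tens x y = tens (a *:l x) y.
Proof. exact: tensor_lactE. Qed.
Lemma ract_tens x y (b : B) : tens x y *:r b = tens x (y *:r b).
Proof. exact: tensor_ractE. Qed.

End Tensor.

Section TensorMaps.
Variable B : pzRingType.

Definition tensor_map (M M' N N' : bimodType B) (f : M -> M') (g : N -> N') :
    tensor M N -> tensor M' N' :=
  tensor_lift (fun x y => tens (f x) (g y)).

Definition tensor_assoc (M N P : bimodType B) :
    tensor (tensor M N) P -> tensor M (tensor N P) :=
  tensor_lift (fun t z => tensor_lift (fun x y => tens x (tens y z)) t).

Definition tensor_unitr (M : bimodType B) : tensor M (rreg B) -> M :=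
  tensor_lift (fun (x : M) (b : rreg B) => x *:r (b : B)).

Definition tensor_unitl (M : bimodType B) : tensor (rreg B) M -> M :=
  tensor_lift (fun (b : rreg B) (x : M) => (b : B) *:l x).

Lemma tensor_map_bal (M M' N N' : bimodType B) (f : bihom M M')
  (g : bihom N N') : balanced (fun x y => tens (f x) (g y)).
Proof.
split=> *; rewrite ?linearD ?tensDl ?tensDr //.
by rewrite linearZ_LR tens_ract bihom_lact.
Qed.

Lemma tensor_assoc_bal_in (M N P : bimodType B) (z : P) :
  balanced (fun (x : M) (y : N) => tens x (tens y z)).
Proof.
split=> *; rewrite ?tensDl ?tensDr //.
by rewrite tens_ract lact_tens.
Qed.

Lemma tensor_assoc_bal (M N P : bimodType B) :
  balanced (fun (t : tensor M N) (z : P) =>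
              tensor_lift (fun x y => tens x (tens y z)) t).
Proof.
have Bi := @tensor_assoc_bal_in M N P.
split=> [s t z|t z z'|t b z]; first exact: tensor_liftD.
- move: t; apply: tensor_ext => [s t|s t|x y].
  + exact: tensor_liftD.
  + by rewrite !tensor_liftD // addrACA.
  + by rewrite !tensor_liftE // !tensDr.
- move: t; apply: tensor_ext => [s t|s t|x y].
  + by rewrite ractDl tensor_liftD.
  + exact: tensor_liftD.
  + by rewrite ract_tens !tensor_liftE // tens_ract.
Qed.

Lemma tensor_assocE (M N P : bimodType B) (x : M) (y : N) (z : P) :
  tensor_assoc (tens (tens x y) z) = tens x (tens y z).
Proof.
rewrite /tensor_assoc tensor_liftE; last exact: tensor_assoc_bal.
by rewrite tensor_liftE //; apply: tensor_assoc_bal_in.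
Qed.

Lemma tensor_unitr_bal (M : bimodType B) :
  balanced (fun (x : M) (b : rreg B) => x *:r (b : B)).
Proof.
split=> *; rewrite ?ractDl ?ractDr //.
by rewrite ractA.
Qed.

Lemma tensor_unitl_bal (M : bimodType B) :
  balanced (fun (b : rreg B) (x : M) => (b : B) *:l x).
Proof.
split=> *; rewrite ?lactDl ?lactDr //.
by rewrite lactA.
Qed.

Lemma tensor_mapE (M M' N N' : bimodType B) (f : bihom M M')
  (g : bihom N N') x y : tensor_map f g (tens x y) = tens (f x) (g y).
Proof. exact: tensor_liftE (tensor_map_bal f g) _ _. Qed.

Lemma tensor_unitrE (M : bimodType B) (x : M) (b : rreg B) :
  tensor_unitr (tens x b) = x *:r (b : B).
Proof. exact: tensor_liftE (@tensor_unitr_bal M) _ _. Qed.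

Lemma tensor_unitlE (M : bimodType B) (b : rreg B) (x : M) :
  tensor_unitl (tens b x) = (b : B) *:l x.
Proof. exact: tensor_liftE (@tensor_unitl_bal M) _ _. Qed.

Section Sums.
Variables (I : Type) (r : seq I).

Lemma tensor_map_sum (M M' N N' : bimodType B) (f : bihom M M')
  (g : bihom N N') (F : I -> tensor M N) :
  tensor_map f g (\sum_(i <- r) F i) = \sum_(i <- r) tensor_map f g (F i).
Proof. exact (tensor_lift_big (tensor_map_bal f g) r F). Qed.

Lemma tensor_assoc_sum (M N P : bimodType B)
  (F : I -> tensor (tensor M N) P) :
  tensor_assoc (\sum_(i <- r) F i) = \sum_(i <- r) tensor_assoc (F i).
Proof. exact (tensor_lift_big (@tensor_assoc_bal M N P) r F). Qed.

Lemma tensor_unitr_sum (M : bimodType B) (F : I -> tensor M (rreg B)) :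
  tensor_unitr (\sum_(i <- r) F i) = \sum_(i <- r) tensor_unitr (F i).
Proof. exact (tensor_lift_big (@tensor_unitr_bal M) r F). Qed.

Lemma tensor_unitl_sum (M : bimodType B) (F : I -> tensor (rreg B) M) :
  tensor_unitl (\sum_(i <- r) F i) = \sum_(i <- r) tensor_unitl (F i).
Proof. exact (tensor_lift_big (@tensor_unitl_bal M) r F). Qed.

End Sums.

Definition idl (M : bimodType B) : bihom M M :=
  @BiHom B M M idfun (fun _ _ => erefl).

Record coring := Coring {
  coring_sort :> bimodType B;
  comul : bihom coring_sort (tensor coring_sort coring_sort);
  counit : bihom coring_sort (rreg B);
  comulA : forall w : coring_sort,
    tensor_assoc (tensor_map comul (idl _) (comul w)) =
    tensor_map (idl _) comul (comul w);
  comul_unitr : forall w : coring_sort,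
    tensor_unitr (tensor_map (idl _) counit (comul w)) = w;
  comul_unitl : forall w : coring_sort,
    tensor_unitl (tensor_map counit (idl _) (comul w)) = w
}.

Definition group_like (W : coring) (w : W) : Prop :=
  comul W w = tens w w /\ counit W w = 1 :> B.

Definition normal_coring (W : coring) : Prop := exists w : W, group_like w.

End TensorMaps.

Definition rdual (B : pzRingType) (M : bimodType B) : Type :=
  {linear M -> rreg B}.

Section Dual.
Variables (B : pzRingType) (M : bimodType B).
Implicit Types (f g h : rdual M) (a b : B).

HB.instance Definition _ := gen_eqMixin (rdual M).
HB.instance Definition _ := gen_choiceMixin (rdual M).

Lemma rdualP f g : (forall x, f x = g x) -> f = g.
Proof.
move=> fg.
case: f g fg => [f [[f1] [f2] ]] [g [[g1] [g2] ]] /= /funext E.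
by case: _ / E g1 g2 => g1 g2; rewrite (Prop_irrelevance f1 g1) (Prop_irrelevance f2 g2).
Qed.

Definition rdual0 : rdual M := \0.
Definition rdual_opp f : rdual M := \- f.
Definition rdual_add f g : rdual M := f \+ g.

Fact rdual_addA : associative rdual_add.
Proof. by move=> f g h; apply: rdualP => x; exact: addrA. Qed.
Fact rdual_addC : commutative rdual_add.
Proof. by move=> f g; apply: rdualP => x; exact: addrC. Qed.
Fact rdual_add0 : left_id rdual0 rdual_add.
Proof. by move=> f; apply: rdualP => x; exact: add0r. Qed.
Fact rdual_addN : left_inverse rdual0 rdual_opp rdual_add.
Proof. by move=> f; apply: rdualP => x; exact: addNr. Qed.
HB.instance Definition _ := GRing.isZmodule.Build (rdual M)
  rdual_addA rdual_addC rdual_add0 rdual_addN.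

Lemma rdualD f g x : (f + g) x = f x + g x.
Proof. by []. Qed.
Lemma rdual_sum I (r : seq I) (F : I -> rdual M) x :
  (\sum_(i <- r) F i) x = \sum_(i <- r) F i x.
Proof. by apply: (big_morph (fun f : rdual M => f x)). Qed.

Definition rdual_lact_fun b f (x : M) : rreg B := b *:l f x.
Fact rdual_lact_linear b f : linear (rdual_lact_fun b f).
Proof. by move=> c x y; rewrite /rdual_lact_fun linearP lactDr lact_scale. Qed.
HB.instance Definition _ b f := GRing.isLinear.Build (B^c) M (rreg B) *:%R
  (rdual_lact_fun b f) (rdual_lact_linear b f).
Definition rdual_lact b f : rdual M := rdual_lact_fun b f.

Definition rdual_ract_fun (b : B^c) f (x : M) : rreg B := f ((b : B) *:l x).
Fact rdual_ract_linear b f : linear (rdual_ract_fun b f).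
Proof. by move=> c x y; rewrite /rdual_ract_fun lactDr lact_scale linearP. Qed.
HB.instance Definition _ b f := GRing.isLinear.Build (B^c) M (rreg B) *:%R
  (rdual_ract_fun b f) (rdual_ract_linear b f).
Definition rdual_ract (b : B^c) f : rdual M := rdual_ract_fun b f.

Fact rdual_ractA (a b : B^c) f :
  rdual_ract a (rdual_ract b f) = rdual_ract (a * b) f.
Proof. by apply: rdualP => x; rewrite /= /rdual_ract_fun /= /rdual_ract_fun lactA. Qed.
Fact rdual_ract1 : left_id 1 rdual_ract.
Proof. by move=> f; apply: rdualP => x; rewrite /= /rdual_ract_fun lact1. Qed.
Fact rdual_ractDr : right_distributive rdual_ract +%R.
Proof. by move=> b f g; apply: rdualP => x. Qed.
Fact rdual_ractDl f : {morph rdual_ract^~ f : a b / a + b}.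
Proof.
move=> a b; apply: rdualP => x.
by rewrite rdualD /= /rdual_ract_fun lactDl linearD.
Qed.
HB.instance Definition _ := GRing.Zmodule_isLmodule.Build (B^c) (rdual M)
  rdual_ractA rdual_ract1 rdual_ractDr rdual_ractDl.

Fact rdual_lactA a b f : rdual_lact a (rdual_lact b f) = rdual_lact (a * b) f.
Proof. by apply: rdualP => x; exact: lactA. Qed.
Fact rdual_lact1 f : rdual_lact 1 f = f.
Proof. by apply: rdualP => x; exact: lact1. Qed.
Fact rdual_lactDr a f g :
  rdual_lact a (f + g) = rdual_lact a f + rdual_lact a g.
Proof. by apply: rdualP => x; exact: lactDr. Qed.
Fact rdual_lactDl a b f :
  rdual_lact (a + b) f = rdual_lact a f + rdual_lact b f.
Proof. by apply: rdualP => x; exact: lactDl. Qed.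
Fact rdual_lact_scale a (b : B^c) f :
  rdual_lact a (b *: f) = b *: rdual_lact a f.
Proof. by apply: rdualP. Qed.
HB.instance Definition _ := isBimodule.Build B (rdual M)
  rdual_lactA rdual_lact1 rdual_lactDr rdual_lactDl rdual_lact_scale.

Lemma rdual_lactE b f x : (b *:l f) x = b *:l f x.
Proof. by []. Qed.
Lemma rdual_ractE f b x : (f *:r b) x = f (b *:l x).
Proof. by []. Qed.

End Dual.

Section Psi.
Variables (B : pzRingType) (M : bimodType B).
Implicit Types (a b : B).

Section PsiPure.
Variables f g : rdual M.

Lemma psi_bal : balanced (fun x y : M => f ((g x : B) *:l y)).
Proof.
split=> *; rewrite ?linearD ?lactDl ?lactDr ?linearD //.
by rewrite linearZ_LR /= lactA.
Qed.

Definition psi_pure_fun : tensor M M -> rreg B :=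
  tensor_lift (fun x y => f ((g x : B) *:l y)).

Fact psi_pure_linear : linear psi_pure_fun.
Proof.
have PD : {morph psi_pure_fun : s t / s + t} by apply: tensor_liftD psi_bal.
move=> b s t; rewrite PD; congr (_ + _).
move: s; apply: tensor_ext => [s s'|s s'|x y].
- by rewrite scalerDr PD.
- by rewrite PD scalerDr.
- rewrite ract_tens /psi_pure_fun !tensor_liftE ?linearZ_LR //; try exact: psi_bal.
  by rewrite lact_scale linearZ_LR.
Qed.
HB.instance Definition _ := GRing.isLinear.Build (B^c) (tensor M M) (rreg B)
  *:%R psi_pure_fun psi_pure_linear.
Definition psi_pure : rdual (tensor M M) := psi_pure_fun.

Lemma psi_pureE x y : psi_pure (tens x y) = f ((g x : B) *:l y).
Proof. exact: (tensor_liftE psi_bal). Qed.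

End PsiPure.

Lemma rdual_tensP (f g : rdual (tensor M M)) :
  (forall x y, f (tens x y) = g (tens x y)) -> f = g.
Proof.
move=> fg; apply: rdualP; apply: tensor_ext => // s t; exact: linearD.
Qed.

Definition psi : tensor (rdual M) (rdual M) -> rdual (tensor M M) :=
  tensor_lift psi_pure.

Lemma psi_pure_bal : balanced psi_pure.
Proof.
split=> [f f' g|f g g'|f b g]; apply: rdual_tensP => x y;
  rewrite ?rdualD !psi_pureE ?rdualD //.
- by rewrite lactDl linearD.
- by rewrite rdual_ractE lactA.
Qed.

Lemma psi_tens f g : psi (tens f g) = psi_pure f g.
Proof. exact: tensor_liftE psi_pure_bal _ _. Qed.

Lemma psiD : {morph psi : s t / s + t}.
Proof. exact: tensor_liftD psi_pure_bal. Qed.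

Lemma psi_sum I (r : seq I) (F : I -> tensor (rdual M) (rdual M)) :
  psi (\sum_(i <- r) F i) = \sum_(i <- r) psi (F i).
Proof.
apply: (big_morph _ psiD).
exact: tensor_lift0 psi_pure_bal.
Qed.

Lemma psi_lact a t : psi (a *:l t) = a *:l psi t.
Proof.
move: t; apply: tensor_ext => [s t|s t|f g].
- by rewrite lactDr psiD.
- by rewrite psiD lactDr.
rewrite lact_tens !psi_tens; apply: rdual_tensP => x y.
by rewrite rdual_lactE !psi_pureE rdual_lactE.
Qed.

Lemma psi_ract t b : psi (t *:r b) = psi t *:r b.
Proof.
move: t; apply: tensor_ext => [s t|s t|f g].
- by rewrite ractDl psiD.
- by rewrite psiD ractDl.
rewrite ract_tens !psi_tens; apply: rdual_tensP => x y.
by rewrite rdual_ractE lact_tens !psi_pureE rdual_ractE.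
Qed.

End Psi.

Section DualBasis.
Variables (B : pzRingType) (M : bimodType B).

Lemma dual_basis : fin_generated M -> projective M ->
  exists (n : nat) (e : 'I_n -> M) (e' : 'I_n -> rdual M),
    forall x, x = \sum_(i < n) e i *:r (e' i x : B).
Proof.
move=> [n [e eP]] prM.
pose g (v : 'rV[B^c]_n) : M := \sum_(i < n) v 0 i *: e i.
have gL : linear g.
  move=> c u v; rewrite /g scaler_sumr -big_split; apply: eq_bigr => i _.
  by rewrite !mxE scalerDl scalerA.
pose gLm := GRing.isLinear.Build (B^c) _ M *:%R g gL.
pose G : {linear 'rV[B^c]_n -> M} := HB.pack g gLm.
have gS : surj G.
  move=> y; have [c ->] := eP y; exists (\row_i c i).
  by apply: eq_bigr => i _; rewrite mxE.
have [h hP] := prM _ _ G idfun gS.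
pose d i (x : M) : rreg B := h x 0 i.
have dL i : linear (d i).
  by move=> c x y; rewrite /d linearP !mxE.
pose dLm i := GRing.isLinear.Build (B^c) M (rreg B) *:%R (d i) (dL i).
pose D i : rdual M := HB.pack (d i) (dLm i).
by exists n, e, D => x; rewrite -[LHS]hP.
Qed.

Variables (n : nat) (e : 'I_n -> M) (e' : 'I_n -> rdual M).
Hypothesis eP : forall x, x = \sum_(i < n) e i *:r (e' i x : B).

Definition slice (h : rdual (tensor M M)) (x : M) (y : M) : rreg B :=
  h (tens x y).
Fact slice_linear h x : linear (slice h x).
Proof. by move=> c y z; rewrite /slice tensDr linearD -ract_tens linearZ_LR. Qed.
HB.instance Definition _ h x := GRing.isLinear.Build (B^c) M (rreg B) *:%R
  (slice h x) (slice_linear h x).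

(* The inverse of psi given by the dual basis (e, e'). *)
Definition phi (h : rdual (tensor M M)) : tensor (rdual M) (rdual M) :=
  \sum_(i < n) tens (slice h (e i) : rdual M) (e' i).

Lemma phiD : {morph phi : h k / h + k}.
Proof.
move=> h k; rewrite /phi -big_split; apply: eq_bigr => i _ /=.
by rewrite -tensDl; congr tens; apply: rdualP.
Qed.

Lemma phiK : cancel phi (@psi B M).
Proof.
move=> h; rewrite /phi psi_sum; apply: rdual_tensP => x y.
rewrite rdual_sum {2}[x]eP tens_suml linear_sum.
by apply: eq_bigr => i _; rewrite psi_tens psi_pureE tens_ract.
Qed.

Lemma psiK : cancel (@psi B M) phi.
Proof.
apply: tensor_ext => // [s t|f g]; first by rewrite psiD phiD.
have {2}-> : g = \sum_(i < n) (g (e i) : B) *:l e' i.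
  apply: rdualP => x; rewrite rdual_sum {1}[x]eP linear_sum.
  by apply: eq_bigr => i _; rewrite linearZ_LR.
rewrite tens_sumr /phi; apply: eq_bigr => i _.
rewrite -tens_ract; congr tens; apply: rdualP => y.
by rewrite /= /slice psi_tens psi_pureE.
Qed.

End DualBasis.

Lemma psi_bij (B : pzRingType) (M : bimodType B) :
  fin_generated M -> projective M -> bijective (@psi B M).
Proof.
move=> fgM prM; have [n [e [e' eP]]] := dual_basis fgM prM.
by exists (phi e e'); [apply: psiK | apply: phiK].
Qed.

(* L as a B-B-bimodule along a ring morphism iota : B -> L. *)
Definition bimod_along (B L : pzRingType) (iota : {rmorphism B -> L}) : Type :=
  L.

Section Extension.
Variables (B L : pzRingType) (iota : {rmorphism B -> L}).
Local Notation ext := (bimod_along iota).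

HB.instance Definition _ := GRing.Zmodule.on ext.

Definition ext_ract (b : B^c) (x : ext) : ext := (x : L) * iota b.
Definition ext_lact (b : B) (x : ext) : ext := iota b * (x : L).

Fact ext_ractA (a b : B^c) x : ext_ract a (ext_ract b x) = ext_ract (a * b) x.
Proof. by rewrite /ext_ract -mulrA -rmorphM. Qed.
Fact ext_ract1 : left_id 1 ext_ract.
Proof. by move=> x; rewrite /ext_ract rmorph1 mulr1. Qed.
Fact ext_ractDr : right_distributive ext_ract +%R.
Proof. by move=> b x y; apply: mulrDl. Qed.
Fact ext_ractDl x : {morph ext_ract^~ x : a b / a + b}.
Proof. by move=> a b; rewrite /ext_ract rmorphD mulrDr. Qed.
HB.instance Definition _ := GRing.Zmodule_isLmodule.Build (B^c) ext
  ext_ractA ext_ract1 ext_ractDr ext_ractDl.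

Fact ext_lactA a b x : ext_lact a (ext_lact b x) = ext_lact (a * b) x.
Proof. by rewrite /ext_lact mulrA -rmorphM. Qed.
Fact ext_lact1 x : ext_lact 1 x = x.
Proof. by rewrite /ext_lact rmorph1 mul1r. Qed.
Fact ext_lactDr a x y : ext_lact a (x + y) = ext_lact a x + ext_lact a y.
Proof. exact: mulrDr. Qed.
Fact ext_lactDl a b x : ext_lact (a + b) x = ext_lact a x + ext_lact b x.
Proof. by rewrite /ext_lact rmorphD mulrDl. Qed.
Fact ext_lact_scale a (b : B^c) x : ext_lact a (b *: x) = b *: ext_lact a x.
Proof. exact: mulrA. Qed.
HB.instance Definition _ := isBimodule.Build B ext
  ext_lactA ext_lact1 ext_lactDr ext_lactDl ext_lact_scale.

Lemma ext_ractE (x : ext) (b : B) : x *:r b = (x : L) * iota b :> L.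
Proof. by []. Qed.
Lemma ext_lactE (x : ext) (b : B) : b *:l x = iota b * (x : L) :> L.
Proof. by []. Qed.

Definition ext_incl_fun (b : rreg B) : ext := iota (b : B).
Fact ext_incl_linear : linear ext_incl_fun.
Proof. by move=> c x y; rewrite /ext_incl_fun rmorphD rmorphM. Qed.
HB.instance Definition _ := GRing.isLinear.Build (B^c) (rreg B) ext *:%R
  ext_incl_fun ext_incl_linear.
Definition ext_incl : {linear rreg B -> ext} := ext_incl_fun.

Definition ext_mul : tensor ext ext -> ext :=
  tensor_lift (fun x y : ext => (x : L) * (y : L) : ext).

Lemma ext_mul_bal : balanced (fun x y : ext => (x : L) * (y : L) : ext).
Proof.
split=> *; [exact: mulrDl | exact: mulrDr |].
by rewrite ext_ractE ext_lactE mulrA.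
Qed.

Lemma ext_mulE x y : ext_mul (tens x y) = (x : L) * (y : L).
Proof. exact: tensor_liftE ext_mul_bal _ _. Qed.

Fact ext_mul_linear : linear ext_mul.
Proof.
have PD : {morph ext_mul : s t / s + t} by apply: tensor_liftD ext_mul_bal.
move=> b s t; rewrite PD; congr (_ + _).
move: s; apply: tensor_ext => [s s'|s s'|x y].
- by rewrite scalerDr PD.
- by rewrite PD scalerDr.
- by rewrite ract_tens !ext_mulE ext_ractE mulrA.
Qed.
HB.instance Definition _ := GRing.isLinear.Build (B^c) (tensor ext ext) ext
  *:%R ext_mul ext_mul_linear.

Definition ext_mul_dual (f : rdual ext) : rdual (tensor ext ext) :=
  f \o ext_mul.

Lemma ext_mul_dualE f x y :
  ext_mul_dual f (tens x y) = f ((x : L) * (y : L)).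
Proof. by rewrite -ext_mulE. Qed.

Section RightDualCoring.
Hypotheses (fgL : fin_generated ext) (prL : projective ext).

Fact psi_surj (h : rdual (tensor ext ext)) : exists t, psi t = h.
Proof. by have [k _ kK] := psi_bij fgL prL; exists (k h). Qed.

Definition psi_inv (h : rdual (tensor ext ext)) :
    tensor (rdual ext) (rdual ext) := sval (cid (psi_surj h)).

Lemma psi_invK : cancel psi_inv (@psi B ext).
Proof. by move=> h; rewrite /psi_inv; case: cid. Qed.
Lemma psiVK : cancel (@psi B ext) psi_inv.
Proof. by move=> t; apply: (bij_inj (psi_bij fgL prL)); rewrite psi_invK. Qed.

Definition dual_comul (f : rdual ext) : tensor (rdual ext) (rdual ext) :=
  psi_inv (ext_mul_dual f).

Lemma dual_comulP f t : psi t = ext_mul_dual f -> dual_comul f = t.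
Proof. by rewrite /dual_comul => <-; exact: psiVK. Qed.

Fact dual_comul_linear : linear dual_comul.
Proof.
move=> b f g; apply: dual_comulP; rewrite psiD psi_ract !psi_invK.
apply: rdual_tensP => x y.
rewrite ext_mul_dualE !rdualD !rdual_ractE lact_tens !ext_mul_dualE.
by congr (f _ + _); apply/esym/(@mulrA L).
Qed.
HB.instance Definition _ := GRing.isLinear.Build (B^c) (rdual ext)
  (tensor (rdual ext) (rdual ext)) *:%R dual_comul dual_comul_linear.

Fact dual_comul_lact a f : dual_comul (a *:l f) = a *:l dual_comul f.
Proof.
apply: dual_comulP; rewrite psi_lact psi_invK.
exact: (@rdualP _ _ (a *:l ext_mul_dual f)).
Qed.

Definition dual_counit (f : rdual ext) : rreg B := f (1 : L).
Fact dual_counit_linear : linear dual_counit.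
Proof.
move=> b f g; rewrite /dual_counit rdualD rdual_ractE; congr (_ + _).
by rewrite -linearZ_LR; congr (f _); apply: etrans (mulr1 _) (esym (mul1r _)).
Qed.
HB.instance Definition _ := GRing.isLinear.Build (B^c) (rdual ext) (rreg B)
  *:%R dual_counit dual_counit_linear.

Definition dual_comul_hom : bihom (rdual ext) (tensor (rdual ext) (rdual ext))
  := BiHom dual_comul_lact.
Definition dual_counit_hom : bihom (rdual ext) (rreg B) :=
  @BiHom B (rdual ext) (rreg B) dual_counit (fun _ _ => erefl).

(* f . x : y |-> f (x y) *)
Definition rdual_mul (f : rdual ext) (x : L) : rdual ext :=
  slice (ext_mul_dual f) (x : ext).

Lemma rdual_mulE f x y : rdual_mul f x y = f (x * (y : L)).
Proof. exact: ext_mul_dualE. Qed.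

Section Coords.
Variables (n : nat) (e : 'I_n -> ext) (e' : 'I_n -> rdual ext).
Hypothesis eP : forall x, x = \sum_(i < n) e i *:r (e' i x : B).

Lemma dual_comulE f :
  dual_comul f = \sum_(i < n) tens (rdual_mul f (e i)) (e' i).
Proof. by apply: dual_comulP; apply: phiK eP _. Qed.

Lemma rdual_coords (g : rdual ext) :
  \sum_(i < n) (g (e i) : B) *:l e' i = g.
Proof.
apply: rdualP => x; rewrite rdual_sum {2}[x]eP linear_sum.
by apply: eq_bigr => i _; rewrite linearZ_LR.
Qed.

Lemma rdual_mul_coords (f : rdual ext) x :
  rdual_mul f x = \sum_(i < n) rdual_mul f (e i) *:r (e' i x : B).
Proof.
apply: rdualP => y; rewrite rdual_sum rdual_mulE {1}[x]eP mulr_suml linear_sum.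
apply: eq_bigr => i _; rewrite rdual_ractE rdual_mulE; congr (f _).
exact/esym/mulrA.
Qed.

Lemma rdual_mulA (f : rdual ext) x y :
  rdual_mul (rdual_mul f x) y = rdual_mul f (x * y).
Proof. by apply: rdualP => z; rewrite !rdual_mulE mulrA. Qed.

End Coords.

Fact dual_comulA f :
  tensor_assoc (tensor_map dual_comul_hom (idl _) (dual_comul_hom f)) =
  tensor_map (idl _) dual_comul_hom (dual_comul_hom f).
Proof.
have [n [e [e' eP]]] := dual_basis fgL prL.
have fE g : dual_comul_hom g = \sum_(i < n) tens (rdual_mul g (e i)) (e' i).
  exact: dual_comulE.
rewrite (fE f) !tensor_map_sum tensor_assoc_sum.
under eq_bigr => i _ do
  rewrite tensor_mapE fE tens_suml tensor_assoc_sum.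
under [RHS]eq_bigr => i _ do rewrite tensor_mapE fE tens_sumr.
rewrite [RHS]exchange_big /=; apply: eq_bigr => i _.
under eq_bigr => j _ do
  rewrite tensor_assocE rdual_mulA (rdual_mul_coords eP) tens_suml.
rewrite exchange_big /=; apply: eq_bigr => k _.
under eq_bigr => j _ do rewrite tens_ract lact_tens -rdual_mulE.
by rewrite -tens_sumr -tens_suml (rdual_coords eP).
Qed.

Fact dual_comul_unitr f :
  tensor_unitr (tensor_map (idl _) dual_counit_hom (dual_comul_hom f)) = f.
Proof.
have [n [e [e' eP]]] := dual_basis fgL prL.
rewrite [dual_comul_hom f](dual_comulE eP) tensor_map_sum tensor_unitr_sum.
under eq_bigr => i _ do rewrite tensor_mapE tensor_unitrE.
rewrite /= -(rdual_mul_coords eP).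
by apply: rdualP => x; rewrite rdual_mulE mul1r.
Qed.

Fact dual_comul_unitl f :
  tensor_unitl (tensor_map dual_counit_hom (idl _) (dual_comul_hom f)) = f.
Proof.
have [n [e [e' eP]]] := dual_basis fgL prL.
rewrite [dual_comul_hom f](dual_comulE eP) tensor_map_sum tensor_unitl_sum.
have cE (x : ext) : dual_counit_hom (rdual_mul f x) = f x.
  by apply: etrans (rdual_mulE f x (1 : L)) _; rewrite mulr1.
under eq_bigr => i _ do rewrite tensor_mapE tensor_unitlE cE.
exact: rdual_coords.
Qed.

Definition right_dual_coring : coring B :=
  Coring dual_comulA dual_comul_unitr dual_comul_unitl.

End RightDualCoring.
End Extension.

Definition right_splitting (B L : pzRingType) (iota : {rmorphism B -> L})
    (p : {linear bimod_along iota -> rreg B}) : Prop :=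
  forall b : rreg B, p (ext_incl iota b) = b.

Definition right_ideal (L : pzRingType) (I : L -> Prop) : Prop :=
  [/\ I 0, forall x y, I x -> I y -> I (x - y) & forall x y, I x -> I (x * y)].

(* Main.v *)
Require Import Defs.
From HB Require Import structures.
From mathcomp Require Import all_boot all_algebra.
From mathcomp Require Import boolp.

(* For (i), a splitting is the same as a functional p with p 1 = 1, i.e. a
   preimage of 1 under the counit, and it gives L / iota B as a retract of L.
   Every value f x of a functional is the value of the counit at f (x _), so
   each map from L to B dies in the cokernel of the counit; if L is a generator,
   this cokernel is therefore zero.
   For (ii), applying psi turns the equation mu w = w (x) w into
   w (x y) = w (w x . y). For a splitting w this says that (x - iota (w x)) y
   lies in ker w, and the elements x - iota (w x) are exactly those of ker w. *)

Set Implicit Arguments.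
Unset Strict Implicit.
Unset Printing Implicit Defensive.

Import GRing.Theory.
Local Open Scope ring_scope.

Section Cokernel.
Variables (R : pzRingType) (U M : lmodType R) (f : {linear U -> M}).

Fact coker_pi_linear : linear (coker_pi f).
Proof. by move=> a x y; rewrite coker_piD -coker_piZ. Qed.
HB.instance Definition _ := GRing.isLinear.Build R M (coker f) *:%R
  (coker_pi f) coker_pi_linear.

Lemma coker_pi_surj : surj (coker_pi f).
Proof. by move=> y; exists (repr y); exact: coker_reprK. Qed.

Lemma coker_pi_eq0 x : coker_pi f x = 0 <-> exists u, x = f u.
Proof. by rewrite -[0](linear0 (coker_pi f)) coker_piP subr0. Qed.

Section Lift.
Variables (N : lmodType R) (h : {linear M -> N}).
Hypothesis hf0 : forall u, h (f u) = 0.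

(** Two representatives of a class differ by an element of the image of [f], which [h] kills. *)
Lemma coker_liftE x : h (repr (coker_pi f x)) = h x.
Proof.
have /coker_piP[u xu] := coker_reprK (coker_pi f x).
by apply/eqP; rewrite -subr_eq0 -linearB xu hf0.
Qed.

Lemma coker_lift_ex :
  exists k : {linear coker f -> N}, forall x, k (coker_pi f x) = h x.
Proof.
pose k (q : coker f) : N := h (repr q).
have kL : linear k.
  move=> a q r; rewrite -[q]coker_reprK -[r]coker_reprK -linearP /k.
  by rewrite !coker_liftE linearP.
pose kLm := GRing.isLinear.Build R (coker f) N *:%R k kL.
by exists (HB.pack k kLm : {linear coker f -> N}) => x; exact: coker_liftE.
Qed.

End Lift.

(** A lift [k] of [h \o coker_pi f] need not vanish on the image of [f]. Subtracting [k \o (f \o p)]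
    corrects this, and the correction is invisible after [g] because [coker_pi f] kills the image of
    [f]. *)
Lemma retraction_projective_coker (p : {linear M -> U}) :
  cancel f p -> projective M -> projective (coker f).
Proof.
move=> fK prM X Y g h gS.
have [k kP] := prM _ _ g (h \o coker_pi f) gS.
have [l lP] := @coker_lift_ex X (k \- (k \o (f \o p)))
  (fun u => etrans (congr1 (fun v => _ - k (f v)) (fK u)) (subrr _)).
exists l => q; have [x <-] := coker_pi_surj q.
rewrite lP linearB !kP /=.
have -> : coker_pi f (f (p x)) = 0 by apply/coker_pi_eq0; exists (p x).
by rewrite linear0 subr0.
Qed.

Lemma projective_coker_retraction :
  injective f -> projective (coker f) ->
  exists p : {linear M -> U}, cancel f p.
Proof.
move=> fI prC.
have [s sP] := prC _ _ (coker_pi f) idfun coker_pi_surj.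
(* Subtracting the section [s] leaves the component of [x] in the image of [f]; injectivity of [f]
   makes its preimage unique, hence linear in [x]. *)
have /choice[p pP] x : exists u, x - s (coker_pi f x) = f u.
  by apply/coker_pi_eq0; rewrite linearB sP subrr.
have pL : linear p.
  move=> a x y; apply: fI; rewrite linearP -!pP !linearP /=.
  by rewrite scalerDr addrACA.
pose pLm := GRing.isLinear.Build R M U *:%R p pL.
exists (HB.pack p pLm : {linear M -> U}) => u; apply: fI; rewrite -pP.
have -> : coker_pi f (f u) = 0 by apply/coker_pi_eq0; exists u.
by rewrite linear0 subr0.
Qed.

(** No map from [P] distinguishes [coker_pi f] from the zero map, so the generator property
    identifies the two. *)
Lemma generator_surj (P : lmodType R) :
  generator P -> (forall (h : {linear P -> M}) x, exists u, h x = f u) ->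
  surj f.
Proof.
move=> genP im y; have /coker_pi_eq0[u ->] : coker_pi f y = 0; last by exists u.
by apply: (genP _ _ (coker_pi f) \0) => h x; apply/coker_pi_eq0/im.
Qed.

End Cokernel.

Section Extension.
Variables (B L : pzRingType) (iota : {rmorphism B -> L}).
Local Notation ext := (bimod_along iota).
Implicit Type p : rdual ext.

Lemma right_splittingP p : right_splitting p <-> p (1 : L) = 1 :> B.
Proof.
split=> [pK|p1 b].
  by apply: etrans (pK 1); congr (p _); exact/esym/rmorph1.
have -> : ext_incl iota b = ((1 : L) : ext) *:r (b : B).
  by rewrite ext_ractE mul1r.
by rewrite linearZ_LR p1; exact: (@mul1r B).
Qed.

Lemma right_splitting_generator p : right_splitting p -> generator ext.
Proof.
move=> /right_splittingP p1 M N f g fg y.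
(* This map sends [1] to [y], so every element of [M] is a value of some map from [ext]. *)
pose h (x : ext) : M := (p x : B^c) *: y.
have hL : linear h.
  by move=> c u v; rewrite /h linearP /= scalerDl scalerA.
pose hLm := GRing.isLinear.Build (B^c) ext M *:%R h hL.
have := fg (HB.pack h hLm : {linear ext -> M}) (1 : L).
by rewrite /= /h p1 scale1r.
Qed.

Lemma rdual_value_counit p x :
  exists q : rdual ext, p x = dual_counit q.
Proof.
exists (rdual_mul p x).
by rewrite /dual_counit rdual_mulE mulr1.
Qed.

Lemma psi_tens_ext_mul_dualP p :
  psi (tens p p) = ext_mul_dual p <->
  forall x y : L, p (iota (p x : B) * y) = p (x * y).
Proof.
split=> [pp x y|pp].
  by rewrite -[RHS]ext_mul_dualE -pp psi_tens psi_pureE.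
by apply: rdual_tensP => x y; rewrite psi_tens psi_pureE ext_mul_dualE -pp.
Qed.

Lemma right_ideal_ker_splittingP p : right_splitting p ->
  right_ideal (fun x : L => p x = 0) <->
  forall x y : L, p (iota (p x : B) * y) = p (x * y).
Proof.
move=> pK; split=> [[_ _ kerM] x y|pp].
  (* The difference of the two sides is [p] at a right multiple of [x - iota (p x)], an element of
     the kernel. *)
  apply/esym/eqP; rewrite -subr_eq0 -linearB -mulrBl; apply/eqP/kerM.
  by apply/eqP; rewrite linearB subr_eq0; apply/eqP/esym/pK.
split=> [|x y x0 y0|x y x0]; first exact: linear0.
- by rewrite linearB x0 y0 subrr.
- by rewrite -pp x0 rmorph0 mul0r; exact: linear0.
Qed.

Hypotheses (fgL : fin_generated ext) (prL : projective ext).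

(** Since [psi] is bijective, the comultiplication condition may be tested after applying it; the
    counit condition is [p 1 = 1]. *)
Lemma dual_group_likeP p :
  group_like (W := right_dual_coring fgL prL) p <->
  right_splitting p /\ right_ideal (fun x : L => p x = 0).
Proof.
split=> [[cp /right_splittingP pK]|[pK idK]].
  split=> //; apply/(right_ideal_ker_splittingP pK)/psi_tens_ext_mul_dualP.
  by rewrite -cp; exact: psi_invK.
split; last exact/right_splittingP.
by apply/dual_comulP/psi_tens_ext_mul_dualP/(right_ideal_ker_splittingP pK).
Qed.

End Extension.

Theorem theorem2p5 (B L : pzRingType) (iota : {rmorphism B -> L})
    (iota_inj : injective iota)
    (fgL : fin_generated (bimod_along iota))
    (projL : projective (bimod_along iota)) :
  [<-> exists p : {linear bimod_along iota -> rreg B}, right_splitting p;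
       projective (coker (ext_incl iota));
       projective (bimod_along iota) /\ generator (bimod_along iota);
       surj (counit (right_dual_coring fgL projL))]
  /\
  ((exists p : {linear bimod_along iota -> rreg B},
      right_splitting p /\ right_ideal (fun x : L => p x = 0%R))
   <-> normal_coring (right_dual_coring fgL projL)).
Proof.
split; last by split=> -[p] => [?|/dual_group_likeP ?]; exists p => //;
  apply/dual_group_likeP.
tfae.
- by move=> [p pK]; exact: retraction_projective_coker pK projL.
- move=> prC; split=> //.
  have [p pK] := projective_coker_retraction (f := ext_incl iota) iota_inj prC.
  exact: right_splitting_generator pK.
- move=> [_ genL].
  apply: (generator_surj (f := counit (right_dual_coring fgL projL)) genL).
  by move=> p x; exact: rdual_value_counit.
(* A preimage of [1] under the counit is a splitting. *)
- by move=> /(_ 1)[p p1]; exists p; apply/right_splittingP.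
Qed.
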